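(* Let $R=\mathbb{C}[x,y,z,w]$ and let $I_4\subseteq R$ be the ideal generated by $$(x^4-y^4)(z^4-w^4)xy,\ (x^4-y^4)(z^4-w^4)zw,\ (x^4-z^4)(y^4-w^4)xz,\ (x^4-z^4)(y^4-w^4)yw,\ (x^4-w^4)(y^4-z^4)xw,\ (x^4-w^4)(y^4-z^4)yz.$$ Then $\alpha(I_4^{(m)})=8m$ for all integers $m\ge 3$ with $m\neq 5$.
   Context: For a homogeneous ideal $I$, $\alpha(I)$ denotes the least degree of a nonzero homogeneous element of $I$. The $m$-th symbolic power is $I^{(m)}=\bigcap_{\mathfrak p\in \operatorname{Ass}(R/I)} (I^mR_{\mathfrak p}\cap R)$. *)

(* Defs.v *)
From HB Require Import structures.
From mathcomp Require Import all_boot all_algebra.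
From mathcomp Require Import complex mpoly.
From mathcomp Require Import Rstruct.
Set Implicit Arguments. Unset Strict Implicit. Unset Printing Implicit Defensive.
Import GRing.Theory.
Local Open Scope ring_scope.

Definition CC : closedFieldType := complex Rdefinitions.R.

Definition Rpoly := {mpoly CC[4]}.

Definition vx : Rpoly := 'X_(@Ordinal 4 0 isT).
Definition vy : Rpoly := 'X_(@Ordinal 4 1 isT).
Definition vz : Rpoly := 'X_(@Ordinal 4 2 isT).
Definition vw : Rpoly := 'X_(@Ordinal 4 3 isT).

Section Ideals.
Variable A : comRingType.

Definition ideal_span (S : A -> Prop) : A -> Prop :=
  fun f => exists (n : nat) (c s : 'I_n -> A),
    (forall i, S (s i)) /\ f = \sum_(i < n) c i * s i.

Definition ideal_pow (I : A -> Prop) (m : nat) : A -> Prop :=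
  ideal_span (fun f => exists a : 'I_m -> A,
                 (forall i, I (a i)) /\ f = \prod_(i < m) a i).

Definition is_ideal (I : A -> Prop) : Prop :=
  I 0 /\ (forall a b, I a -> I b -> I (a + b)) /\ (forall r a, I a -> I (r * a)).

Definition is_prime_ideal (P : A -> Prop) : Prop :=
  is_ideal P /\ ~ P 1 /\ (forall a b, P (a * b) -> P a \/ P b).

Definition is_associated_prime (I P : A -> Prop) : Prop :=
  is_prime_ideal P /\ exists f : A, forall g, P g <-> I (g * f).

(* I^m A_p \cap A = { f | s f \in I^m for some s \notin p } *)
Definition local_contraction (J P : A -> Prop) : A -> Prop :=
  fun f => exists s, ~ P s /\ J (s * f).

Definition symbolic_power (I : A -> Prop) (m : nat) : A -> Prop :=
  fun f => forall P, is_associated_prime I P ->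
             local_contraction (ideal_pow I m) P f.
End Ideals.

Definition alpha_eq (J : Rpoly -> Prop) (d : nat) : Prop :=
  (exists f : Rpoly, J f /\ f != 0 /\ f \is d.-homog) /\
  (forall (f : Rpoly) (e : nat), J f -> f != 0 -> f \is e.-homog -> (d <= e)%N).

Definition I4_gens : seq Rpoly :=
  [:: (vx^+4 - vy^+4) * (vz^+4 - vw^+4) * vx * vy;
      (vx^+4 - vy^+4) * (vz^+4 - vw^+4) * vz * vw;
      (vx^+4 - vz^+4) * (vy^+4 - vw^+4) * vx * vz;
      (vx^+4 - vz^+4) * (vy^+4 - vw^+4) * vy * vw;
      (vx^+4 - vw^+4) * (vy^+4 - vz^+4) * vx * vw;
      (vx^+4 - vw^+4) * (vy^+4 - vz^+4) * vy * vz].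

Definition I4 : Rpoly -> Prop := ideal_span (fun f => f \in I4_gens).

(* Main.v *)
(* Put F = (x^4-y^4)(z^4-w^4), G = (x^4-z^4)(y^4-w^4), H = (x^4-w^4)(y^4-z^4), so that
   F - G + H = 0.

   Upper bound: for m = a + b + c with 4a, 4b, 4c >= m (possible as soon as m >= 3 and m <> 5),
   the form F^a G^b H^c of degree 8m lies in the symbolic power. Let P be an associated prime.
   If at most one variable is in P, then F, G, H lie in I4 up to the product of the others; if
   P contains exactly x and y, then I4 is locally (x, y) and F is in (x, y)^4. No associated
   prime contains three variables: I4 is the intersection of (F, G) with the ideals of the six
   lines where two variables vanish, every variable is a nonzerodivisor modulo (F, G), and each
   of the six lines avoids one of any three coordinate planes.

   Lower bound: the 64 lines where three of the variables agree up to fourth roots of unity are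
   associated primes, so an element f of the symbolic power has order at least m along each.
   The plane x = a y contains eight of them; if f has degree less than 8m, its restriction to
   that plane is divisible by the m-th power of eight linear forms, hence is zero. So f is
   divisible by FGH, of degree 24 and order exactly 3 along each line: induct with m - 3. *)
Require Import Defs.
From HB Require Import structures.
From mathcomp Require Import all_boot all_algebra.
From mathcomp Require Import complex mpoly.
From mathcomp Require Import ring zify.
From mathcomp Require Import Rstruct.
From Stdlib Require Import Classical_Prop.
Set Implicit Arguments. Unset Strict Implicit. Unset Printing Implicit Defensive.
Import GRing.Theory Num.Theory.
Local Open Scope ring_scope.

(** * Divisibility in integral domains *)

Section Divisibility.
Variable A : idomainType.
Implicit Types p q f h : A.

Definition divides p f := exists c, f = c * p.

(** [q] is a nonzerodivisor modulo [p]: a one-sided coprimality that makes do without unique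
    factorization. *)
Definition cop p q := forall h, divides p (q * h) -> divides p h.

(** The hypotheses make [(p)] the kernel of a map into a domain, hence prime, and [q] lies outside
    it. *)
Lemma cop_ker (B : idomainType) (phi : {rmorphism A -> B}) p q :
  (forall f, phi f = 0 -> divides p f) -> phi p = 0 -> phi q != 0 -> cop p q.
Proof.
move=> kerP phip0 phiq h [c /(congr1 phi)].
rewrite !rmorphM phip0 mulr0 => /eqP; rewrite mulf_eq0 (negPf phiq) => /eqP.
exact: kerP.
Qed.

Lemma copMl p1 p2 q : p1 != 0 -> cop p1 q -> cop p2 q -> cop (p1 * p2) q.
Proof.
move=> p1_neq0 cop1 cop2 h [c qhE].
have [|h1 hE] := cop1 h; first by exists (c * p2); rewrite qhE; ring.
have [|h2 h1E] := cop2 h1; last by exists h2; rewrite hE h1E; ring.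
by exists c; apply: (mulIf p1_neq0); move: qhE; rewrite hE => qhE; ring: qhE.
Qed.

Lemma copMr p q1 q2 : cop p q1 -> cop p q2 -> cop p (q1 * q2).
Proof. by move=> cop1 cop2 h; rewrite -mulrA => /cop1 /cop2. Qed.

Lemma cop_expl p q m : p != 0 -> cop p q -> cop (p ^+ m) q.
Proof.
move=> p_neq0 cop_pq; elim: m => [|m IH]; first by move=> h _; exists h; rewrite mulr1.
by rewrite exprS; apply: copMl.
Qed.

Lemma cop_expr p q m : cop p q -> cop p (q ^+ m).
Proof.
move=> cop_pq; elim: m => [|m IH]; first by move=> h; rewrite mul1r.
by rewrite exprS; apply: copMr.
Qed.

Lemma cop_prodl (I : eqType) (s : seq I) (p : I -> A) q :
  (forall i, i \in s -> p i != 0) -> (forall i, i \in s -> cop (p i) q) ->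
  cop (\prod_(i <- s) p i) q.
Proof.
elim: s => [|i s IH] p_neq0 cops.
  by rewrite big_nil => h _; exists h; rewrite mulr1.
rewrite big_cons; apply: copMl; rewrite ?p_neq0 ?mem_head //.
  by apply: cops; rewrite mem_head.
by apply: IH => j js; [apply: p_neq0 | apply: cops]; rewrite in_cons js orbT.
Qed.

Lemma cop_prodr (I : eqType) (s : seq I) p (q : I -> A) :
  (forall i, i \in s -> cop p (q i)) -> cop p (\prod_(i <- s) q i).
Proof.
elim: s => [|i s IH] cops; first by rewrite big_nil => h; rewrite mul1r.
rewrite big_cons; apply: copMr; first by apply: cops; rewrite mem_head.
by apply: IH => j js; apply: cops; rewrite in_cons js orbT.
Qed.

(** Peel off one factor at a time: [p i] divides the product of the others times the cofactor [h],
    so by coprimality it divides [h]. *)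
Lemma divides_prod (I : eqType) (s : seq I) (p : I -> A) f :
  uniq s -> (forall i, i \in s -> divides (p i) f) ->
  (forall i j, i \in s -> j \in s -> i != j -> cop (p i) (p j)) ->
  divides (\prod_(i <- s) p i) f.
Proof.
elim: s => [|i s IH] /=; first by move=> *; exists f; rewrite big_nil mulr1.
move=> /andP[i_s uniq_s] divs cops.
have [||h fE] := IH uniq_s.
- by move=> j js; apply: divs; rewrite in_cons js orbT.
- by move=> j k js ks; apply: cops; rewrite in_cons ?js ?ks orbT.
have [||g hE] := @cop_prodr _ s (p i) p _ h.
- move=> j js; apply: cops; rewrite ?mem_head ?in_cons ?js ?orbT //.
  by apply: contraNneq i_s => ->.
- by rewrite mulrC -fE; apply: divs; rewrite mem_head.
by exists g; rewrite fE hE big_cons mulrA.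
Qed.

End Divisibility.

(** * Ideals and their powers *)

Section Ideals.
Variable A : comRingType.
Implicit Types I J : A -> Prop.

Lemma ideal_span_is_ideal (S : A -> Prop) : is_ideal (ideal_span S).
Proof.
split; first by exists 0%N, (fun=> 0), (fun=> 0); split=> [[]//|]; rewrite big_ord0.
split=> [a b [n [c [s [sS ->]]]] [n' [c' [s' [sS' ->]]]]|r a [n [c [s [sS ->]]]]].
  exists (n + n')%N, (fun i => match split i with inl j => c j | inr j => c' j end),
    (fun i => match split i with inl j => s j | inr j => s' j end).
  split=> [i|]; first by case: (split i).
  rewrite big_split_ord /=; congr (_ + _); apply: eq_bigr => i _.
    by rewrite -[lshift _ i]/(unsplit (inl i)) unsplitK.
  by rewrite -[rshift _ i]/(unsplit (inr i)) unsplitK.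
exists n, (fun i => r * c i), s; split=> //.
by rewrite mulr_sumr; apply: eq_bigr => i _; rewrite mulrA.
Qed.

Lemma mem_ideal_span (S : A -> Prop) a : S a -> ideal_span S a.
Proof.
by move=> Sa; exists 1%N, (fun=> 1), (fun=> a); split=> //; rewrite big_ord1 mul1r.
Qed.

Lemma ideal_span_min (S J : A -> Prop) :
  is_ideal J -> (forall a, S a -> J a) -> forall a, ideal_span S a -> J a.
Proof.
move=> [J0 [JD JM]] SJ a [n [c [s [sS ->]]]].
by apply: big_ind => // i _; apply/JM/SJ.
Qed.

Lemma ideal_opp J a : is_ideal J -> J a -> J (- a).
Proof. by move=> [_ [_ JM]] Ja; rewrite -mulN1r; apply: JM. Qed.

Lemma ideal_mulr J a b : is_ideal J -> J a -> J (a * b).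
Proof. by move=> [_ [_ JM]] Ja; rewrite mulrC; apply: JM. Qed.

Lemma ideal_pow_is_ideal I m : is_ideal (ideal_pow I m).
Proof. exact: ideal_span_is_ideal. Qed.

Lemma ideal_powM I m n a b :
  ideal_pow I m a -> ideal_pow I n b -> ideal_pow I (m + n) (a * b).
Proof.
have idl := ideal_pow_is_ideal I (m + n).
move=> Ia Ib; move: a Ia; apply: ideal_span_min.
  split=> [|]; first by rewrite mul0r; case: idl.
  split=> [x y|r x] Ix; first by move=> Iy; rewrite mulrDl; apply: idl.2.1.
  by rewrite -mulrA; apply: idl.2.2.
move=> _ [u [uI ->]]; move: b Ib; apply: ideal_span_min.
  split=> [|]; first by rewrite mulr0; case: idl.
  split=> [x y|r x] Ix; first by move=> Iy; rewrite mulrDr; apply: idl.2.1.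
  by rewrite mulrCA; apply: idl.2.2.
move=> _ [v [vI ->]]; apply: mem_ideal_span.
exists (fun i => match split i with inl j => u j | inr j => v j end).
split=> [i|]; first by case: (split i).
rewrite big_split_ord /=; congr (_ * _); apply: eq_bigr => i _.
  by rewrite -[lshift _ i]/(unsplit (inl i)) unsplitK.
by rewrite -[rshift _ i]/(unsplit (inr i)) unsplitK.
Qed.

Lemma ideal_pow0 I a : ideal_pow I 0 a.
Proof.
rewrite -[a]mulr1; apply: (ideal_pow_is_ideal I 0).2.2.
by apply: mem_ideal_span; exists (fun=> 0); split=> [[]//|]; rewrite big_ord0.
Qed.

Lemma ideal_pow_exp I m a : I a -> ideal_pow I m (a ^+ m).
Proof.
move=> Ia; apply: mem_ideal_span; exists (fun=> a); split=> //.
by rewrite prodr_const card_ord.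
Qed.

Lemma ideal_pow_leq I m n a : (m <= n)%N -> ideal_pow I n a -> ideal_pow I m a.
Proof.
move=> le_mn; move: a; apply: ideal_span_min; first exact: ideal_pow_is_ideal.
move=> _ [u [uI ->]]; move: u uI; rewrite -(subnKC le_mn) => u uI.
rewrite big_split_ord /=; apply: ideal_mulr; first exact: ideal_pow_is_ideal.
by apply: mem_ideal_span; exists (fun i => u (lshift _ i)).
Qed.

End Ideals.

Lemma ideal_powX (A : comRingType) (I : A -> Prop) m n a :
  ideal_pow I m a -> ideal_pow I (m * n) (a ^+ n).
Proof.
move=> Ia; elim: n => [|n IH]; first by rewrite muln0; apply: ideal_pow0.
by rewrite mulnS exprS; apply: ideal_powM.
Qed.

(** Used with [phi] a chart of the blow-up of a line and [p] the exceptional parameter: membership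
    in [I^m] becomes vanishing to order [m]. *)
Lemma ideal_pow_divides (A : comRingType) (B : idomainType)
    (phi : {rmorphism A -> B}) (I : A -> Prop) p m f :
  (forall a, I a -> divides p (phi a)) ->
  ideal_pow I m f -> divides (p ^+ m) (phi f).
Proof.
move=> Ip; move: f; apply: ideal_span_min.
  split; first by exists 0; rewrite rmorph0 mul0r.
  split=> [f g [c fE] [d gE]|r f [c fE]].
    by exists (c + d); rewrite rmorphD fE gE mulrDl.
  by exists (phi r * c); rewrite rmorphM fE mulrA.
move=> _ [a [aI ->]]; elim: m a aI => [|m IH] a aI.
  by exists (phi (\prod_(i < 0) a i)); rewrite mulr1.
rewrite big_ord_recl rmorphM; have [c ->] := Ip _ (aI ord0).
have [d ->] := IH (fun i => a (lift ord0 i)) (fun i => aI _).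
by exists (c * d); rewrite exprS; ring.
Qed.

Lemma mul_exp3 (A : comRingType) (t x y z : A) a b c :
  t ^+ (a + (b + c)) * (x ^+ a * (y ^+ b * z ^+ c)) =
  (t * x) ^+ a * ((t * y) ^+ b * (t * z) ^+ c).
Proof. by rewrite !exprMn !exprD; ring. Qed.

Lemma prime_ideal_exp (A : comRingType) (P : A -> Prop) s n :
  is_prime_ideal P -> P (s ^+ n) -> P s.
Proof.
move=> [_ [P1 PM]]; elim: n => [/P1 //|n IH].
by rewrite exprS => /PM[].
Qed.

(** * Substitutions in polynomial rings *)

Section Substitution.
Variables (K : fieldType) (n : nat).
Local Notation R := {mpoly K[n]}.

(** The [f] with [phi f] congruent to [psi f] modulo [J] are closed under sums and products, so
    constants and variables decide. *)
Lemma rmorphism_congr (B : comRingType) (J : B -> Prop)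
    (phi psi : {rmorphism R -> B}) :
  is_ideal J -> (forall c, phi c%:MP = psi c%:MP) ->
  (forall i, J (phi 'X_i - psi 'X_i)) -> forall f, J (phi f - psi f).
Proof.
move=> idJ eqC congrX; have [J0 [JD JM]] := idJ.
have congrM a b : J (phi a - psi a) -> J (phi b - psi b) ->
    J (phi (a * b) - psi (a * b)).
  move=> Ja Jb; rewrite !rmorphM.
  have -> : phi a * phi b - psi a * psi b =
     phi b * (phi a - psi a) + psi a * (phi b - psi b) by ring.
  by apply: JD; apply: JM.
elim/mpolyind => [|c m p _ _ IH]; first by rewrite !rmorph0 subrr.
rewrite !rmorphD.
have -> : phi (c *: 'X_[m]) + phi p - (psi (c *: 'X_[m]) + psi p) =
   (phi (c *: 'X_[m]) - psi (c *: 'X_[m])) + (phi p - psi p) by ring.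
apply: JD => //; rewrite -mul_mpolyC; apply: (congrM); first by rewrite eqC subrr.
rewrite mpolyXE_id; apply: (big_ind (fun a => J (phi a - psi a))).
- by rewrite !rmorph1 subrr.
- exact: congrM.
move=> i _; elim: (m i) => [|k IHk]; first by rewrite !rmorph1 subrr.
by rewrite exprS; apply: congrM.
Qed.

Lemma rmorphism_ext (B : comRingType) (phi psi : {rmorphism R -> B}) :
  (forall c, phi c%:MP = psi c%:MP) -> (forall i, phi 'X_i = psi 'X_i) ->
  phi =1 psi.
Proof.
move=> eqC eqX f; apply/eqP; rewrite -subr_eq0; apply/eqP.
apply: (@rmorphism_congr B (fun b => b = 0)) => //.
  by split=> //; split=> [a b -> ->|r a ->]; rewrite ?addr0 ?mulr0.
by move=> i; rewrite eqX subrr.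
Qed.

Definition subst (h : 'I_n -> R) : R -> R := mmap (@mpolyC n K) h.
HB.instance Definition _ h := GRing.RMorphism.on (subst h).

Lemma substX h i : subst h 'X_i = h i.
Proof. by rewrite /subst mmapX mmap1U. Qed.

Lemma substC h c : subst h c%:MP = c%:MP.
Proof. by rewrite /subst mmapC. Qed.

(** The primes of lines appear as kernels of substitutions, which are prime because the target is a
    domain. *)
Lemma subst_ker_prime h : is_prime_ideal (fun f => subst h f = 0).
Proof.
split; first split; first exact: rmorph0.
  by split=> [f g f0 g0|r f f0]; rewrite ?rmorphD ?rmorphM /= ?f0 ?g0 ?addr0 ?mulr0.
split; first by move/eqP; rewrite rmorph1 oner_eq0.
by move=> f g /eqP; rewrite rmorphM mulf_eq0 => /orP[] /eqP; [left | right].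
Qed.

(** The case [j = k] is allowed and serves substitutions of a single variable. *)
Lemma subst_congr2 h j k f :
  (forall i, i != j -> i != k -> h i = 'X_i) ->
  exists c d, f - subst h f = c * ('X_j - h j) + d * ('X_k - h k).
Proof.
move=> hE.
apply: (@rmorphism_congr R
  (fun g => exists c d, g = c * ('X_j - h j) + d * ('X_k - h k)) idfun (subst h)).
- split; first by exists 0, 0; ring.
  split=> [a b [c [d ->]] [c' [d' ->]]|r a [c [d ->]]].
    by exists (c + c'), (d + d'); ring.
  by exists (r * c), (r * d); ring.
- by move=> c; rewrite [RHS]substC.
move=> i /=; rewrite substX; have [->|ij] := eqVneq i j; first by exists 1, 0; ring.
have [->|ik] := eqVneq i k; first by exists 0, 1; ring.
by exists 0, 0; rewrite hE //; ring.
Qed.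

Lemma msize_mul_leq (p q : R) : (msize (p * q) <= (msize p + msize q).-1)%N.
Proof.
have [->|p_neq0] := eqVneq p 0; first by rewrite mul0r msize0.
have [->|q_neq0] := eqVneq q 0; first by rewrite mulr0 msize0.
by rewrite msizeM.
Qed.

(** [msize] is the degree plus one, so the hypothesis says that every [h i] has degree at most
    one. *)
Lemma msize_subst_le h f :
  (forall i, msize (h i) <= 2)%N -> (msize (subst h f) <= msize f)%N.
Proof.
move=> h_le; rewrite /subst /mmap.
have powle (p : R) e : (msize p <= 2)%N -> (msize (p ^+ e) <= e.+1)%N.
  move=> p_le; elim: e => [|e IH]; first by rewrite expr0 msize1.
  rewrite exprS; apply: leq_trans (msize_mul_leq _ _) _; lia.
have mmap1le m : (msize (mmap1 h m) <= (mdeg m).+1)%N.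
  rewrite /mmap1 mdegE.
  apply: (big_ind2 (fun (p : R) e => msize p <= e.+1)%N) => [|p a q b lep leq|i _].
  - by rewrite msize1.
  - by apply: leq_trans (msize_mul_leq _ _) _; lia.
  - exact: powle.
rewrite big_seq; apply: (big_ind (fun p : R => (msize p <= msize f)%N)).
- by rewrite msize0.
- by move=> p q lep leq; apply: leq_trans (msizeD_le _ _) _; rewrite geq_max lep.
move=> m m_f; rewrite mul_mpolyC; apply: leq_trans (msizeZ_le _ _) _.
exact: leq_trans (mmap1le m) (msize_mdeg_lt m_f).
Qed.

End Substitution.

Lemma msize_dhomog (K : fieldType) n d (f : {mpoly K[n]}) :
  f != 0 -> f \is d.-homog -> msize f = d.+1.
Proof.
move=> f_neq0 f_homog; rewrite (dhomog_uniq f_neq0 f_homog (dhomog_msize f_homog)).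
by rewrite prednK // lt0n msize_poly_eq0.
Qed.

Lemma mpolyX_neq0 (K : fieldType) n m : 'X_[m] != 0 :> {mpoly K[n]}.
Proof. by rewrite -msize_poly_eq0 msizeX. Qed.

Lemma dhomog_prod_const (K : fieldType) n d (I : Type) (s : seq I)
    (p : I -> {mpoly K[n]}) :
  (forall t, p t \is d.-homog) -> \prod_(t <- s) p t \is (size s * d).-homog.
Proof.
move=> p_homog; elim: s => [|t s IH]; first by rewrite big_nil dhomog1.
by rewrite big_cons mulSn dhomogM.
Qed.

(** With indices in closed form, the finite checks on variables reduce to computation. *)
Lemma ord4_ind (P : 'I_4 -> Prop) :
  P (@Ordinal 4 0 isT) -> P (@Ordinal 4 1 isT) -> P (@Ordinal 4 2 isT) ->
  P (@Ordinal 4 3 isT) -> forall i, P i.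
Proof.
by move=> P0 P1 P2 P3 [[|[|[|[|//]]]] lti]; rewrite (bool_irrelevance lti isT).
Qed.

Lemma divides_X_horner0 (A : idomainType) (p : {poly A}) :
  p.[0] = 0 -> divides 'X p.
Proof. by move=> /eqP/factor_theorem[q ->]; exists q; rewrite subr0. Qed.

Lemma cop_Xn (A : idomainType) (p : {poly A}) m : p.[0] != 0 -> cop ('X ^+ m) p.
Proof.
move=> p0; apply: cop_expl; first by rewrite polyX_eq0.
apply: (@cop_ker _ _ (horner_eval 0)) => //; first exact: divides_X_horner0.
by rewrite /= horner_evalE hornerX.
Qed.

(** * Orders of vanishing along lines *)

Section Lines.
Variables (K : fieldType) (zeta : K).
Hypothesis zeta2 : zeta ^+ 2 = -1.
Hypothesis two_neq0 : 2%:R != 0 :> K.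
Local Notation R := {mpoly K[4]}.
Implicit Types (i j k l : 'I_4) (a b c : K) (f g : R).

Definition roots4 : seq K := [:: 1; zeta; -1; - zeta].

Lemma roots4P a : a \in roots4 -> a ^+ 4 = 1.
Proof.
have z4 : zeta ^+ 4 = 1 by rewrite (exprM zeta 2 2) zeta2; ring.
by rewrite !inE => /or4P[] /eqP->; [ring | | ring | rewrite -z4; ring].
Qed.

Lemma roots4_neq0 a : a \in roots4 -> a != 0.
Proof.
move=> /roots4P a4; apply: contra_eq_neq a4 => ->.
by rewrite expr0n eq_sym oner_eq0.
Qed.

Lemma roots4_uniq : uniq roots4.
Proof.
have neqN c : c != 0 -> c != - c.
  move=> c0; rewrite -subr_eq0 opprK -mulr2n -mulr_natl mulf_neq0 //.
have z_neq0 : zeta != 0.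
  by apply: contra_eq_neq zeta2 => ->; rewrite expr0n eq_sym oppr_eq0 oner_eq0.
have neq_sqr c d : c ^+ 2 = 1 -> d ^+ 2 = -1 -> c != d.
  move=> c2 d2; apply: contra_neq two_neq0 => cd.
  by rewrite -[2%:R]/(1 + 1) -{1}c2 cd d2; ring.
rewrite /= !inE !negb_or !andbT !neqN ?oner_eq0 //.
rewrite [zeta == _]eq_sym !neq_sqr ?sqrrN ?expr1n //.
Qed.

Definition lin j i a : R := 'X_j - a%:MP * 'X_i.

Lemma prod_lin j i : \prod_(a <- roots4) lin j i a = 'X_j ^+ 4 - 'X_i ^+ 4.
Proof.
rewrite !big_cons big_nil /lin !mpolyCN mpolyC1.
have : (zeta%:MP) ^+ 2 = -1 :> R by rewrite -rmorphXn /= zeta2 mpolyCN mpolyC1.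
set z : R := _%:MP; move=> z2.
rewrite (_ : _ * _ = ('X_j ^+ 2 - 'X_i ^+ 2) * ('X_j ^+ 2 - z ^+ 2 * 'X_i ^+ 2)); last ring.
by rewrite z2; ring.
Qed.

Lemma mpolyX_sub_neq0 i j a b : i != j -> a != 0 -> a%:MP * 'X_i - b%:MP * 'X_j != 0 :> R.
Proof.
move=> ij; apply: contraNneq => /(congr1 (meval (fun l => (l == i)%:R))).
rewrite mevalB !mevalM !mevalC !mevalXU eqxx eq_sym (negPf ij).
by rewrite mulr0 mulr1 subr0 => ->.
Qed.

Lemma mpolyCX_neq0 i a : a != 0 -> a%:MP * 'X_i != 0 :> R.
Proof. by move=> a0; rewrite mulf_neq0 ?mpolyC_eq0 // mpolyX_neq0. Qed.

Lemma lin_neq0 j i a : j != i -> lin j i a != 0.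
Proof.
by move=> ji; have := mpolyX_sub_neq0 a ji (oner_neq0 K); rewrite mpolyC1 mul1r.
Qed.

Lemma dhomog_lin j i a : lin j i a \is 1.-homog.
Proof.
by rewrite dhomogD // ?dhomogN ?mul_mpolyC ?dhomogZ // dhomogX /= mdeg1.
Qed.

Definition setvar j (g : R) i : R := if i == j then g else 'X_i.

Lemma setvar_congr j g f : divides ('X_j - g) (f - subst (setvar j g) f).
Proof.
have [i|c [d ->]] := @subst_congr2 _ _ (setvar j g) j j f.
  by rewrite /setvar => /negPf ->.
by exists (c + d); rewrite {1 2}/setvar eqxx; ring.
Qed.

Lemma setvar_ker j g f : subst (setvar j g) f = 0 -> divides ('X_j - g) f.
Proof. by move=> f0; have := setvar_congr j g f; rewrite f0 subr0. Qed.

Lemma cop_setvar j g h : subst (setvar j g) g = g ->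
  subst (setvar j g) h != 0 -> cop ('X_j - g) h.
Proof.
move=> gfix; apply: cop_ker => [f|]; first exact: setvar_ker.
by rewrite rmorphB /= gfix substX /setvar eqxx subrr.
Qed.

Lemma subst_lin j g l i b :
  subst (setvar j g) (lin l i b) = setvar j g l - b%:MP * setvar j g i.
Proof. by rewrite /lin rmorphB rmorphM /= substC !substX. Qed.

(** Modulo ['X_j - a 'X_i] the second form stays nonzero unless the two are proportional;
    [(l, k) != (i, j)] excludes proportional forms written for the reversed pair of variables. *)
Lemma cop_lin j i a l k b : i != j -> k != l -> a != 0 ->
  (l, k) != (i, j) -> (j, i, a) != (l, k, b) -> cop (lin j i a) (lin l k b).
Proof.
move=> ij kl a0 lkij neq; apply: cop_setvar.
  by rewrite rmorphM /= substC substX /setvar (negPf ij).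
rewrite subst_lin /setvar; move: neq kl lkij.
rewrite !xpair_eqE; have [-> neq kj _|lj _ kl] := eqVneq l j.
  rewrite (negPf kj).
  have [ki|ki] := eqVneq i k; last exact: mpolyX_sub_neq0.
  move: neq; rewrite ki !eqxx /= => ab.
  by rewrite -mulrBl -mpolyCB mpolyCX_neq0 // subr_eq0.
rewrite -['X_l]mul1r -mpolyC1; have [_|kj] := eqVneq k j.
  rewrite andbT => li; rewrite mulrA -mpolyCM mpolyX_sub_neq0 ?oner_eq0 //.
by move=> _; rewrite mpolyX_sub_neq0 ?oner_eq0 // eq_sym.
Qed.

(* Affine chart ['X_j = a 'X_i + T 'X_j], ['X_k = b 'X_i + T] of the blow-up of the line
   ['X_j = a 'X_i], ['X_k = b 'X_i]: the order of vanishing of [f] along the line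
   is the order of [blowup f] in [T]. *)
Definition blowup i j k a b : R -> {poly R} :=
  mmap (polyC \o @mpolyC 4 K) (fun l =>
    if l == j then (a%:MP * 'X_i)%:P + ('X_j)%:P * 'X
    else if l == k then (b%:MP * 'X_i)%:P + 'X else ('X_l)%:P).
HB.instance Definition _ i j k a b := GRing.RMorphism.on (blowup i j k a b).

Lemma blowupX i j k a b l : blowup i j k a b 'X_l =
    if l == j then (a%:MP * 'X_i)%:P + ('X_j)%:P * 'X
    else if l == k then (b%:MP * 'X_i)%:P + 'X else ('X_l)%:P.
Proof. by rewrite /blowup mmapX mmap1U. Qed.

Definition on_line i j k a b l : R :=
  if l == j then a%:MP * 'X_i else if l == k then b%:MP * 'X_i else 'X_l.

(** The exceptional divisor [T = 0] maps to the line itself, so [f] vanishes on the line exactly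
    when its blow-up is divisible by [T]. *)
Lemma blowup0 i j k a b f :
  (blowup i j k a b f).[0] = subst (on_line i j k a b) f.
Proof.
apply: (@rmorphism_ext _ _ _ (horner_eval 0 \o blowup i j k a b)
  (subst (on_line i j k a b))) => [c|l] /=.
  by rewrite [RHS]substC /blowup mmapC /= horner_evalE hornerC.
rewrite substX blowupX /on_line horner_evalE.
by case: ifP => _; [|case: ifP => _]; rewrite !hornerE ?mulr0 ?addr0.
Qed.

(** Putting 0 for the ['X_j] of the coefficients and ['X_k - b 'X_i] for [T] turns the chart into
    the restriction to the plane ['X_j = a 'X_i], and [T^m] into the m-th power of the equation of
    the line in that plane. *)
Lemma blowup_plane i j k a b m f : i != j -> i != k -> j != k ->
  divides ('X ^+ m) (blowup i j k a b f) ->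
  divides (lin k i b ^+ m) (subst (setvar j (a%:MP * 'X_i)) f).
Proof.
move=> ij ik jk [q /(congr1 (fun p => (map_poly (subst (setvar j 0)) p).[lin k i b]))].
have -> : (map_poly (subst (setvar j 0)) (blowup i j k a b f)).[lin k i b] =
    subst (setvar j (a%:MP * 'X_i)) f.
  apply: (@rmorphism_ext _ _ _
    (horner_eval (lin k i b) \o map_poly (subst (setvar j 0)) \o blowup i j k a b)
    (subst (setvar j (a%:MP * 'X_i)))) => [c|l] /=.
    by rewrite [RHS]substC /blowup mmapC /= map_polyC horner_evalE hornerC /= substC.
  rewrite substX blowupX horner_evalE {2}/setvar.
  case: ifP => [_|lj].
    rewrite rmorphD rmorphM /= !map_polyC /= map_polyX !hornerE rmorphM /= substC.
    by rewrite !substX /setvar eqxx (negPf ij) mul0r addr0.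
  case: ifP => [/eqP->|_].
    rewrite rmorphD /= map_polyC /= map_polyX !hornerE rmorphM /= substC.
    by rewrite substX /setvar (negPf ij) /lin; ring.
  by rewrite map_polyC hornerC /= substX /setvar lj.
move=> ->; rewrite rmorphM rmorphXn /= map_polyX hornerM hornerXn.
by eexists.
Qed.

(** The three variables of the triple have the same fourth power on the line. A difference of two of
    these powers vanishes there, to first order only because its [T]-coefficient is nonzero; any
    other difference does not vanish. *)
Lemma blowup_fourth i j k a b l l' :
  uniq [:: i; j; k] -> a \in roots4 -> b \in roots4 -> l != l' ->
  exists2 u, blowup i j k a b ('X_l ^+ 4 - 'X_l' ^+ 4) =
      u * 'X ^+ ((l \in [:: i; j; k]) && (l' \in [:: i; j; k])) & u.[0] != 0.
Proof.
rewrite /= andbT in_cons !mem_seq1 negb_or => /andP[/andP[ij ik] jk] a_root b_root ll'.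
have [a4 b4] := (roots4P a_root, roots4P b_root).
have [a0 b0] := (roots4_neq0 a_root, roots4_neq0 b_root).
(* Uniform shape of the chart: every ['X_l] goes to [r l * 'X_(t l) + s l * T], with [r l] a fourth
   root of unity. *)
pose r l := if l == j then a else if l == k then b else 1.
pose s l := if l == j then 'X_j else if l == k then 1 else 0 : R.
pose t l := if (l == j) || (l == k) then i else l.
have sigmaE l0 : blowup i j k a b 'X_l0 = ((r l0)%:MP * 'X_(t l0))%:P + (s l0)%:P * 'X.
  rewrite blowupX /r /s /t; case: eqP => //= _; case: eqP => //= _.
    by rewrite mul1r.
  by rewrite mpolyC1 mul1r mul0r addr0.
have r4 l0 : (r l0)%:MP ^+ 4 = 1 :> R.
  by rewrite -rmorphXn /= /r; case: ifP => _; [|case: ifP => _];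
    rewrite ?a4 ?b4 ?expr1n mpolyC1.
rewrite rmorphB !rmorphXn /= !sigmaE.
set A := (r l)%:MP * _; set B := s l; set C := (r l')%:MP * _; set D := s l'.
have t_on l0 : l0 \in [:: i; j; k] -> t l0 = i.
  by rewrite !inE /t => /or3P[] /eqP->; rewrite ?eqxx ?orbT //; case: ifP.
have t_off l0 : l0 \notin [:: i; j; k] -> t l0 = l0.
  by rewrite !inE /t; case: (l0 == j); rewrite ?orbT //=; case: (l0 == k); rewrite ?orbT.
have X4_neq0 p q : p != q -> 'X_p ^+ 4 - 'X_q ^+ 4 != 0 :> R.
  move=> pq; rewrite -prod_lin prodf_seq_neq0; apply/allP => c _.
  exact: lin_neq0.
have value0 : ((A%:P + B%:P * 'X) ^+ 4 - (C%:P + D%:P * 'X) ^+ 4).[0] =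
    'X_(t l) ^+ 4 - 'X_(t l') ^+ 4.
  by rewrite !hornerE /A /C !exprMn !r4 !mul1r.
have [lon|loff] /= := boolP (l \in [:: i; j; k]); last first.
  eexists; first by rewrite /= expr0 mulr1.
  rewrite value0 X4_neq0 // t_off // /t; case: ifP => // _.
  by apply: contraNneq loff => ->; rewrite mem_head.
have [l'on|l'off] /= := boolP (l' \in [:: i; j; k]); last first.
  eexists; first by rewrite /= expr0 mulr1.
  rewrite value0 X4_neq0 // (t_off l') // /t; case: ifP => // _.
  by apply: contraNneq l'off => <-; rewrite mem_head.
have AC : A ^+ 4 = C ^+ 4 by rewrite /A /C !exprMn !r4 !t_on.
(* Binomial expansion divided by [T]; the constant terms [A ^+ 4] and [C ^+ 4] cancel. *)
exists ((4%:R * (A ^+ 3 * B - C ^+ 3 * D))%:P +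
        'X * (6%:R * (A ^+ 2 * B ^+ 2 - C ^+ 2 * D ^+ 2)%:P +
        'X * (4%:R * (A * B ^+ 3 - C * D ^+ 3)%:P +
        'X * (B ^+ 4 - D ^+ 4)%:P))).
  have AC' : A%:P ^+ 4 = C%:P ^+ 4 :> {poly R} by rewrite -!rmorphXn AC.
  by rewrite expr1; ring: AC'.
rewrite hornerD hornerC hornerM hornerX mul0r addr0 /A /C !t_on //.
rewrite (_ : _ * _ = 4%:R * 'X_i ^+ 3 * ((r l)%:MP ^+ 3 * B - (r l')%:MP ^+ 3 * D)); last ring.
rewrite !mulf_neq0 ?expf_neq0 ?mpolyX_neq0 //.
  by rewrite -mpolyC_nat mpolyC_eq0 (natrM _ 2 2) mulf_neq0.
(* On [i], [j], [k] the values of [r^3 s] are 0, [a^3 'X_j] and [b^3]; it remains to see that they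
   are pairwise different. *)
have aX : a%:MP ^+ 3 * 'X_j != 0 :> R by rewrite -rmorphXn mpolyCX_neq0 ?expf_neq0.
have b3 : b%:MP ^+ 3 != 0 :> R by rewrite expf_neq0 ?mpolyC_eq0.
have aXb : a%:MP ^+ 3 * 'X_j - b%:MP ^+ 3 != 0 :> R.
  rewrite subr_eq0; apply: contra_neq b0 => /(congr1 (meval (fun=> 0))).
  rewrite mevalM mevalXU mulr0 -rmorphXn mevalC => /esym/eqP.
  by rewrite expf_eq0 => /eqP.
rewrite /B /D /r /s; move: lon l'on ll'; rewrite !inE.
move=> /or3P[] /eqP-> /or3P[] /eqP->; rewrite ?eqxx // => _;
  rewrite ?(negPf ij) ?(negPf ik) ?[k == j]eq_sym ?(negPf jk) ?eqxx;
  rewrite ?mulr0 ?mulr1 ?sub0r ?subr0 ?oppr_eq0 //.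
by rewrite -opprB oppr_eq0.
Qed.

(** * The 24 planes and descent on the order of vanishing *)

Definition ord4s : seq 'I_4 :=
  [:: @Ordinal 4 0 isT; @Ordinal 4 1 isT; @Ordinal 4 2 isT; @Ordinal 4 3 isT].

Lemma mem_ord4s i : i \in ord4s.
Proof. by elim/ord4_ind: i. Qed.

Definition vars_pairs : seq ('I_4 * 'I_4) :=
  [seq p : 'I_4 * 'I_4 <- [seq (i, j) | i <- ord4s, j <- ord4s] | (p.1 < p.2)%N].

(** This is the product [F G H], the equation of the 24 planes ['X_i = a 'X_j]. *)
Definition vandermonde : R := \prod_(p <- vars_pairs) ('X_p.1 ^+ 4 - 'X_p.2 ^+ 4).

Lemma vars_pairsP i j : ((i, j) \in vars_pairs) = (i < j)%N.
Proof.
rewrite mem_filter andb_idr // => _.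
by apply: (allpairs_f (fun i j => (i, j))); apply: mem_ord4s.
Qed.

Lemma vars_pairs_uniq : uniq vars_pairs.
Proof. by rewrite filter_uniq // allpairs_uniq // => -[? ?] []. Qed.

Lemma dhomog_fourth i j : ('X_i ^+ 4 - 'X_j ^+ 4 : R) \is 4.-homog.
Proof.
rewrite -prod_lin; apply: (@dhomog_prod_const _ _ 1 _ roots4) => c.
exact: dhomog_lin.
Qed.

(** Exactly three of the six pairs lie within the triple, and each contributes one factor [T]. *)
Lemma blowup_vandermonde i j k a b :
  uniq [:: i; j; k] -> a \in roots4 -> b \in roots4 ->
  exists2 u, blowup i j k a b vandermonde = u * 'X ^+ 3 & u.[0] != 0.
Proof.
move=> ijk a_root b_root; rewrite /vandermonde.
pose e (p : 'I_4 * 'I_4) := (p.1 \in [:: i; j; k]) && (p.2 \in [:: i; j; k]).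
have pairs3 : count e vars_pairs = 3%N.
  rewrite /e; move: ijk; clear.
  by elim/ord4_ind: i; elim/ord4_ind: j; elim/ord4_ind: k.
suff [u uE u0] : exists2 u, blowup i j k a b
    (\prod_(p <- vars_pairs) ('X_p.1 ^+ 4 - 'X_p.2 ^+ 4)) =
    u * 'X ^+ count e vars_pairs & u.[0] != 0.
  by exists u; rewrite // uE pairs3.
have {pairs3} : all (fun p => p.1 != p.2) vars_pairs.
  by apply/allP => -[p q]; rewrite vars_pairsP ltn_neqAle => /andP[].
elim: vars_pairs => [_|[p q] s IH] /=.
  by exists 1; rewrite ?big_nil ?rmorph1 ?mulr1 // hornerC oner_eq0.
move=> /andP[pq /IH[u uE u0]]; rewrite big_cons rmorphM /= uE.
have [v -> v0] := blowup_fourth ijk a_root b_root pq.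
by exists (v * u); rewrite ?exprD ?hornerM ?mulf_neq0 // /e /=; ring.
Qed.

(** The 24 linear forms are pairwise coprime, as [i < j] fixes one order for each pair of
    variables. *)
Lemma divides_vandermonde f :
  (forall i j a, i != j -> a \in roots4 -> subst (setvar j (a%:MP * 'X_i)) f = 0) ->
  divides vandermonde f.
Proof.
move=> f0; rewrite /vandermonde.
rewrite (eq_bigr _ (fun p _ => esym (prod_lin p.1 p.2))).
have <- : \prod_(t <- [seq (p, a) | p <- vars_pairs, a <- roots4]) lin t.1.1 t.1.2 t.2 =
    \prod_(p <- vars_pairs) \prod_(a <- roots4) lin p.1 p.2 a by rewrite big_allpairs_dep.
apply: divides_prod.
- by rewrite allpairs_uniq ?vars_pairs_uniq ?roots4_uniq // => -[? ?] [].
- move=> _ /allpairsP[[[i j] a] [+ a_root ->]] /=; rewrite vars_pairsP => ij.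
  by apply/setvar_ker/f0; rewrite // neq_ltn ij orbT.
move=> _ _ /allpairsP[[[i j] a] [+ a_root ->]] /allpairsP[[[k l] b] [+ b_root ->]] /=.
rewrite !vars_pairsP => ij kl; apply: cop_lin; rewrite ?(roots4_neq0 a_root) //.
- by rewrite neq_ltn ij orbT.
- by rewrite neq_ltn kl orbT.
by apply: contraTneq kl => -[-> ->]; rewrite -leqNgt ltnW.
Qed.

(** [g] stands for the restriction of [f] to a plane ['X_j = a 'X_i]. Two variables [k] and four
    roots [b] give eight coprime forms, and the product of their m-th powers has degree [8 * m]. *)
Lemma plane_msize i j m f g :
  i != j -> g != 0 -> (msize g <= msize f)%N ->
  (forall k b, k != i -> k != j -> b \in roots4 -> divides (lin k i b ^+ m) g) ->
  (8 * m < msize f)%N.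
Proof.
move=> ij g0 le_gf div_g.
pose ks := [seq k <- ord4s | (k != i) && (k != j)].
have ks_size : size ks = 2%N.
  by rewrite /ks; move: ij; clear; elim/ord4_ind: i; elim/ord4_ind: j.
have ks_uniq : uniq ks by rewrite filter_uniq.
have := @divides_prod _ _ [seq (k, b) | k <- ks, b <- roots4]
  (fun t => lin t.1 i t.2 ^+ m) g.
case.
- by rewrite allpairs_uniq ?roots4_uniq // => -[? ?] [].
- move=> _ /allpairsP[[k b] [+ b_root ->]] /=.
  by rewrite mem_filter => /andP[/andP[ki kj] _]; apply: div_g.
- move=> _ _ /allpairsP[[k b] [+ b_root ->]] /allpairsP[[l c] [+ c_root ->]] /=.
  rewrite !mem_filter => /andP[/andP[ki kj] _] /andP[/andP[li lj] _] neq.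
  apply: cop_expl; first exact: lin_neq0.
  apply/cop_expr/cop_lin; rewrite ?(roots4_neq0 b_root) 1?[i == _]eq_sym //.
    by rewrite xpair_eqE negb_and li.
  by apply: contra_neq neq => -[-> ->].
set Q := \prod_(_ <- _) _ => c gE; move: le_gf.
have [c0 Q0] : c != 0 /\ Q != 0 by apply/andP; rewrite -negb_or -mulf_eq0 -gE.
have Q_homog : Q \is (8 * m).-homog.
  rewrite (_ : 8 * m = size [seq (k, b) | k <- ks, b <- roots4] * m)%N; last first.
    by rewrite size_allpairs ks_size.
  apply: dhomog_prod_const => t; have := dhomogMn m (dhomog_lin t.1 i t.2).
  by rewrite mul1n.
rewrite gE msizeM // (msize_dhomog Q0 Q_homog).
have := msize_poly_eq0 c; rewrite (negPf c0); lia.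
Qed.

Lemma msize_gt_of_order m f : f != 0 ->
  (forall i j k a b, uniq [:: i; j; k] -> a \in roots4 -> b \in roots4 ->
     divides ('X ^+ m) (blowup i j k a b f)) ->
  (8 * m < msize f)%N.
Proof.
elim/ltn_ind: m f => m IH f f0 ordf; rewrite ltnNge; apply/negP => le_f.
have [|g fE] := @divides_vandermonde f.
  move=> i j a ij a_root; apply/eqP/negPn/negP => sf0; move: le_f.
  apply/negP; rewrite -ltnNge; apply: (plane_msize ij sf0).
    apply: msize_subst_le => l; rewrite /setvar; case: ifP => _; last by rewrite msizeX mdeg1.
    by rewrite mul_mpolyC (leq_trans (msizeZ_le _ _)) // msizeX mdeg1.
  move=> k b ki kj b_root; rewrite eq_sym in ki; rewrite eq_sym in kj.
  by apply: blowup_plane => //; apply: ordf => //; rewrite /= !inE negb_or ij ki kj.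
have [g0 V0] : g != 0 /\ vandermonde != 0.
  by apply/andP; rewrite -negb_or -mulf_eq0 -fE.
have V_homog : vandermonde \is 24.-homog.
  apply: (@dhomog_prod_const _ _ 4 _ vars_pairs) => p; exact: dhomog_fourth.
have msize_f : msize f = (msize g + 24)%N.
  by rewrite fE msizeM // (msize_dhomog V0 V_homog) addnS.
(* From [24 <= msize f <= 8 * m] follows [m >= 3], so the truncated subtraction [m - 3] is exact. *)
suff : (8 * (m - 3) < msize g)%N by move: le_f; rewrite msize_f; clear; lia.
have lt_m : (m - 3 < m)%N by move: le_f; rewrite msize_f; clear; lia.
apply: (IH _ lt_m g g0).
move=> i j k a b ijk a_root b_root.
have [u sVE u0] := blowup_vandermonde ijk a_root b_root.
have [q] := ordf i j k a b ijk a_root b_root.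
(* The cofactor [u] of [T^3] has nonzero constant term, so it is coprime to [T^(m-3)] and can be
   multiplied in. *)
rewrite fE rmorphM /= sVE => qE; apply: (cop_Xn u0).
exists q; apply: (@mulIf _ ('X ^+ 3)); first by rewrite expf_neq0 ?polyX_eq0.
have m3 : m = (m - 3 + 3)%N by move: le_f; rewrite msize_f; clear; lia.
by move: qE; rewrite {1}m3 exprD => qE; ring: qE.
Qed.
End Lines.

(** Reduces an identity to a known one [u = v] and an equality of differences that [ring]
    decides. *)
Lemma eq_of_sub (V : zmodType) (u v x y : V) : u = v -> x - y = u - v -> x = y.
Proof. by move=> -> /eqP; rewrite subrr subr_eq0 => /eqP. Qed.

(** * The pencil of octic surfaces *)

Section Saturation.
Variables (K : fieldType) (zeta : K).
Hypothesis zeta2 : zeta ^+ 2 = -1.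
Hypothesis two_neq0 : 2%:R != 0 :> K.
Local Notation R := {mpoly K[4]}.
Implicit Types (i j k l p q r s : 'I_4) (f : R).

(** For distinct indices these are, up to sign, [F], [G] and [H]. *)
Definition quad i j k l : R := ('X_i ^+ 4 - 'X_j ^+ 4) * ('X_k ^+ 4 - 'X_l ^+ 4).

Lemma fourth_neq0 i j : i != j -> 'X_i ^+ 4 - 'X_j ^+ 4 != 0 :> R.
Proof.
move=> ij; rewrite -(prod_lin zeta2) prodf_seq_neq0; apply/allP => c _.
exact: lin_neq0.
Qed.

Lemma X4_neq0 i : 'X_i ^+ 4 != 0 :> R.
Proof. by rewrite expf_neq0 ?mpolyX_neq0. Qed.

Lemma quadC i j k l : quad k l i j = quad i j k l.
Proof. exact: mulrC. Qed.

Lemma quad_neq0 i j k l : i != j -> k != l -> quad i j k l != 0.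
Proof. by move=> ij kl; rewrite mulf_neq0 ?fourth_neq0. Qed.

Lemma dhomog_quad i j k l : quad i j k l \is 8.-homog.
Proof. exact: (dhomogM (dhomog_fourth zeta2 i j) (dhomog_fourth zeta2 k l)). Qed.

(** At ['X_i = 0] the two forms become [- F0] and [- G0], which are still coprime. So the
    restrictions of [A] and [B] are a multiple of the Koszul relation, and removing that relation
    lets ['X_i] cancel. *)
Lemma quad_nonzerodivisor i j k l f (A B : R) : uniq [:: i; j; k; l] ->
  'X_i * f = A * quad i j k l + B * quad i k j l ->
  exists A' B', f = A' * quad i j k l + B' * quad i k j l.
Proof.
rewrite /= andbT !in_cons !in_nil !orbF !negb_or.
move=> /and3P[/and3P[ij ik il] /andP[jk jl] kl] fE.
pose tau : {rmorphism R -> R} := subst (setvar i (0 : R)).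
have tauE p : tau 'X_p = setvar i 0 p by exact: substX.
have tauX p : p != i -> tau 'X_p = 'X_p by move=> /negPf pi; rewrite tauE /setvar pi.
have tauXi : tau 'X_i = 0 by rewrite tauE /setvar eqxx.
pose F0 : R := 'X_j ^+ 4 * ('X_k ^+ 4 - 'X_l ^+ 4).
pose G0 : R := 'X_k ^+ 4 * ('X_j ^+ 4 - 'X_l ^+ 4).
have tauF : tau (quad i j k l) = - F0.
  by rewrite /quad rmorphM !rmorphB !rmorphXn tauXi !tauX 1?eq_sym // /F0; ring.
have tauG : tau (quad i k j l) = - G0.
  by rewrite /quad rmorphM !rmorphB !rmorphXn tauXi !tauX 1?eq_sym // /G0; ring.
have rel : tau A * F0 = - tau B * G0.
  move: fE => /(congr1 tau).
  rewrite rmorphD (rmorphM _ 'X_i) (rmorphM _ A) (rmorphM _ B) tauXi tauF tauG => e.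
  by apply: (eq_of_sub e); ring.
have F0_neq0 : F0 != 0 by rewrite mulf_neq0 ?X4_neq0 ?fourth_neq0.
have copFG : cop F0 G0.
  apply: copMl; first exact: X4_neq0.
    apply: cop_expl; rewrite ?mpolyX_neq0 // -['X_j]subr0; apply: cop_setvar.
      by rewrite rmorph0.
    rewrite rmorphM rmorphB !rmorphXn /= !substX /setvar eqxx ![_ == j]eq_sym.
    by rewrite (negPf jk) (negPf jl) expr0n sub0r mulf_neq0 ?oppr_eq0 ?X4_neq0.
  rewrite -(prod_lin zeta2); apply: cop_prodl => a a_root; first exact: lin_neq0.
  apply: cop_setvar.
    by rewrite rmorphM /= substC substX /setvar eq_sym (negPf kl).
  rewrite rmorphM rmorphB !rmorphXn /= !substX /setvar eqxx ![_ == k]eq_sym.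
  rewrite [k == j]eq_sym (negPf jk) (negPf kl) mulf_neq0 ?fourth_neq0 //.
  by rewrite expf_neq0 // mpolyCX_neq0 // (roots4_neq0 zeta2 a_root).
have [|u tauB] := copFG (tau B); first by exists (- tau A); rewrite mulNr rel; ring.
have tauA : tau A = - u * G0.
  by apply: (mulIf F0_neq0); rewrite rel tauB; ring.
have [a aE] := setvar_congr i 0 A; have [b bE] := setvar_congr i 0 B.
have [c cE] := setvar_congr i 0 (quad i j k l).
have [d dE] := setvar_congr i 0 (quad i k j l).
rewrite subr0 -[subst _ _]/(tau _) in aE bE cE dE.
(* Once [A], [B], [F0], [G0] are expanded in ['X_i], the terms [u G F] and [- u F G] cancel and the
   rest is divisible by ['X_i]. *)
exists (a - u * d), (b + u * c).
apply: (mulfI (mpolyX_neq0 K U_(i))); rewrite fE.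
set F := quad i j k l in tauF cE *; set G := quad i k j l in tauG dE *.
have -> : A = a * 'X_i - u * G0 by rewrite -aE tauA; ring.
have -> : B = b * 'X_i + u * F0 by rewrite -bE tauB; ring.
have -> : F0 = c * 'X_i - F by rewrite -cE tauF; ring.
have -> : G0 = d * 'X_i - G by rewrite -dE tauG; ring.
ring.
Qed.

Lemma ord4_cover i j k l p : uniq [:: i; j; k; l] -> p \in [:: i; j; k; l].
Proof.
elim/ord4_ind: i; elim/ord4_ind: j => //; elim/ord4_ind: k => //;
elim/ord4_ind: l => // _; by elim/ord4_ind: p.
Qed.

(** * Vanishing on the six coordinate lines *)

Definition zero2 p q r : R := if (r == p) || (r == q) then 0 else 'X_r.

Lemma zero2E p q r : zero2 p q r = if (r == p) || (r == q) then 0 else 'X_r.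
Proof. by []. Qed.

Lemma zero2_congr p q f :
  exists c d, f - subst (zero2 p q) f = c * 'X_p + d * 'X_q.
Proof.
have [i ip iq|c [d ->]] := @subst_congr2 _ _ (zero2 p q) p q f.
  by rewrite /zero2 (negPf ip) (negPf iq).
by exists c, d; rewrite /zero2 !eqxx orbT; ring.
Qed.

Lemma zero2_ker p q f : subst (zero2 p q) f = 0 -> exists c d, f = c * 'X_p + d * 'X_q.
Proof. by move=> f0; have := zero2_congr p q f; rewrite f0 subr0. Qed.

(** Write [f = c 'X_r + d 'X_s] and reduce [c], [d] modulo [('X_p, 'X_q)]: the residues contribute
    the restriction of [f] to ['X_p = 'X_q = 0], which is zero. *)
Lemma zero2_ker_cap p q r s f : uniq [:: p; q; r; s] ->
  subst (zero2 p q) f = 0 -> subst (zero2 r s) f = 0 ->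
  exists c1 c2 c3 c4,
    f = c1 * ('X_p * 'X_r) + c2 * ('X_p * 'X_s) + c3 * ('X_q * 'X_r) + c4 * ('X_q * 'X_s).
Proof.
rewrite /= andbT !in_cons !in_nil !orbF !negb_or.
move=> /and3P[/and3P[pq pr ps] /andP[qr qs] rs] f0 /zero2_ker[c [d fE]]; move: f0; rewrite fE.
have [c1 [c2 /eqP]] := zero2_congr p q c; have [d1 [d2 /eqP]] := zero2_congr p q d.
rewrite !subr_eq => /eqP dE /eqP cE.
rewrite rmorphD !rmorphM /= !substX {2 4}/zero2 ![_ == p]eq_sym ![_ == q]eq_sym.
rewrite (negPf pr) (negPf ps) (negPf qr) (negPf qs) /= => e.
exists c1, d1, c2, d2; rewrite {1}cE {1}dE; apply: (eq_of_sub e); ring.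
Qed.

Lemma zero2_quad p q i j k l : p != q -> uniq [:: i; j; k; l] ->
  subst (zero2 p q) (quad i j k l * ('X_i * 'X_j)) = 0.
Proof.
move=> pq ijkl; rewrite !rmorphM !rmorphB !rmorphXn /= !substX !zero2E.
have := ord4_cover q ijkl; have := ord4_cover p ijkl; rewrite !inE.
move=> /or4P[] /eqP p_eq /or4P[] /eqP q_eq; move: pq; rewrite p_eq q_eq.
all: first [by case/eqP | move=> _].
all: by rewrite !eqxx ?orbT ?subrr ?mul0r ?mulr0 ?mul0r ?mulr0.
Qed.

Lemma zero2_cancel p q r f : r != p -> r != q ->
  subst (zero2 p q) ('X_r * f) = 0 -> subst (zero2 p q) f = 0.
Proof.
move=> rp rq /eqP; rewrite rmorphM /= substX zero2E (negPf rp) (negPf rq) mulf_eq0.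
by rewrite (negPf (mpolyX_neq0 _ _)) => /eqP.
Qed.

(** On each coordinate line one of the three forms of the pencil vanishes and the other two become
    the same nonzero monomial up to sign. Hence [B] vanishes on two of the lines, [A] on two others
    and [A + B] on the last two, which leaves only quadratic monomials in [A] and [B]. *)
Lemma mem_of_vanishing (J : R -> Prop) i j k l (A B : R) :
  is_ideal J -> uniq [:: i; j; k; l] ->
  J (quad i j k l * ('X_i * 'X_j)) -> J (quad i j k l * ('X_k * 'X_l)) ->
  J (quad i k j l * ('X_i * 'X_k)) -> J (quad i k j l * ('X_j * 'X_l)) ->
  J (quad i l j k * ('X_i * 'X_l)) -> J (quad i l j k * ('X_j * 'X_k)) ->
  (forall p q, p != q -> subst (zero2 p q) (A * quad i j k l + B * quad i k j l) = 0) ->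
  J (A * quad i j k l + B * quad i k j l).
Proof.
move=> [J0 [JD JM]] ijkl JF1 JF2 JG1 JG2 JH1 JH2 vanish.
have := ijkl; rewrite /= andbT !in_cons !in_nil !orbF !negb_or.
move=> /and3P[/and3P[ij ik il] /andP[jk jl] kl].
have [ji ki li] : [/\ j != i, k != i & l != i] by split; rewrite eq_sym.
have [kj lj lk] : [/\ k != j, l != j & l != k].
  by split; rewrite eq_sym.
pose distinct := (negPf ij, negPf ik, negPf il, negPf jk, negPf jl, negPf kl,
  (negPf ji, negPf ki, negPf li, negPf kj, negPf lj, negPf lk)).
have XX_neq0 p q : 'X_p ^+ 4 * 'X_q ^+ 4 != 0 :> R by rewrite mulf_neq0 ?X4_neq0.
have evalE p q : subst (zero2 p q) (A * quad i j k l + B * quad i k j l) =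
  subst (zero2 p q) A *
    ((zero2 p q i ^+ 4 - zero2 p q j ^+ 4) * (zero2 p q k ^+ 4 - zero2 p q l ^+ 4)) +
  subst (zero2 p q) B *
    ((zero2 p q i ^+ 4 - zero2 p q k ^+ 4) * (zero2 p q j ^+ 4 - zero2 p q l ^+ 4)).
  by rewrite rmorphD !rmorphM !rmorphB !rmorphXn /= !substX.
have Bij : subst (zero2 i j) B = 0.
  have := vanish i j ij; rewrite evalE /zero2 !eqxx ?orbT !distinct /= => e.
  by apply: (mulIf (XX_neq0 k l)); apply: (eq_of_sub e); ring.
have Bkl : subst (zero2 k l) B = 0.
  have := vanish k l kl; rewrite evalE /zero2 !eqxx ?orbT !distinct /= => e.
  by apply: (mulIf (XX_neq0 i j)); apply: (eq_of_sub e); ring.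
have Aik : subst (zero2 i k) A = 0.
  have := vanish i k ik; rewrite evalE /zero2 !eqxx ?orbT !distinct /= => e.
  by apply: (mulIf (XX_neq0 j l)); apply: (eq_of_sub e); ring.
have Ajl : subst (zero2 j l) A = 0.
  have := vanish j l jl; rewrite evalE /zero2 !eqxx ?orbT !distinct /= => e.
  by apply: (mulIf (XX_neq0 i k)); apply: (eq_of_sub e); ring.
have ABil : subst (zero2 i l) (A + B) = 0.
  have := vanish i l il; rewrite evalE rmorphD /zero2 !eqxx ?orbT !distinct /= => e.
  by apply: (mulIf (XX_neq0 j k)); apply: (eq_of_sub (esym e)); ring.
have ABjk : subst (zero2 j k) (A + B) = 0.
  have := vanish j k jk; rewrite evalE rmorphD /zero2 !eqxx ?orbT !distinct /= => e.
  by apply: (mulIf (XX_neq0 i l)); apply: (eq_of_sub (esym e)); ring.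
have [c1 [c2 [c3 [c4 BE]]]] := zero2_ker_cap ijkl Bij Bkl.
have [|a1 [a2 [a3 [a4 AE]]]] := zero2_ker_cap _ Aik Ajl.
  by rewrite /= !inE !distinct.
(* Modulo J only [((a2 + c2) 'X_i 'X_l + (a3 + c3) 'X_j 'X_k) * quad i k j l] is left, because
   [quad i j k l = quad i k j l - quad i l j k]. *)
have [|p1 [p2 pE]] := @zero2_ker j k (a2 + c2).
  apply: (mulIf (mulf_neq0 (mpolyX_neq0 K U_(i)) (mpolyX_neq0 K U_(l)))).
  move: ABjk; rewrite AE BE !rmorphD !rmorphM /= !substX.
  by rewrite !zero2E !eqxx ?orbT !distinct /= => e; apply: (eq_of_sub e); ring.
have [|q1 [q2 qE]] := @zero2_ker i l (a3 + c3).
  apply: (mulIf (mulf_neq0 (mpolyX_neq0 K U_(j)) (mpolyX_neq0 K U_(k)))).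
  move: ABil; rewrite AE BE !rmorphD !rmorphM /= !substX.
  by rewrite !zero2E !eqxx ?orbT !distinct /= => e; apply: (eq_of_sub e); ring.
rewrite AE BE.
(* [p1], [p2], [q1], [q2] supply the missing variable: for example ['X_i * 'X_l * 'X_j] is a
   multiple of ['X_j * 'X_l], which multiplies [quad i k j l] into [J]. *)
rewrite [X in J X](_ : _ =
   a1 * (quad i j k l * ('X_i * 'X_j)) + a4 * (quad i j k l * ('X_k * 'X_l)) +
   (c1 + p2 * 'X_l + q1 * 'X_j) * (quad i k j l * ('X_i * 'X_k)) +
   (c4 + p1 * 'X_i + q2 * 'X_k) * (quad i k j l * ('X_j * 'X_l)) +
   (- a2 * (quad i l j k * ('X_i * 'X_l)) + - a3 * (quad i l j k * ('X_j * 'X_k)))); last first.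
  have -> : c2 = p1 * 'X_j + p2 * 'X_k - a2 by rewrite -pE; ring.
  have -> : c3 = q1 * 'X_i + q2 * 'X_l - a3 by rewrite -qE; ring.
  by rewrite /quad; ring.
by do ![apply: (JD)]; apply: (JM).
Qed.

(** * The lines where three variables agree up to fourth roots of unity *)

Lemma on_line_fourth i j k a b p :
  a ^+ 4 = 1 -> b ^+ 4 = 1 -> p \in [:: i; j; k] ->
  on_line i j k a b p ^+ 4 = 'X_i ^+ 4 :> R.
Proof.
move=> a4 b4; rewrite !inE /on_line; have [_ _|_] := eqVneq p j.
  by rewrite exprMn -rmorphXn /= a4 mpolyC1 mul1r.
have [_ _|_] := eqVneq p k; first by rewrite exprMn -rmorphXn /= b4 mpolyC1 mul1r.
by rewrite !orbF => /eqP->.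
Qed.

(** One of the two differences in [quad p q r s] avoids ['X_l], and on the line the other three
    variables have equal fourth powers. *)
Lemma on_line_quad i j k l a b p q r s : a ^+ 4 = 1 -> b ^+ 4 = 1 ->
  uniq [:: i; j; k; l] -> uniq [:: p; q; r; s] ->
  subst (on_line i j k a b) (quad p q r s * ('X_p * 'X_q)) = 0.
Proof.
move=> a4 b4 ijkl.
have on4 p' : p' != l -> on_line i j k a b p' ^+ 4 = 'X_i ^+ 4 :> R.
  move=> p'l; apply: on_line_fourth => //; have := ord4_cover p' ijkl.
  by rewrite !inE (negPf p'l) orbF.
rewrite /= andbT !in_cons !in_nil !orbF !negb_or.
move=> /and3P[/and3P[pq pr ps] /andP[qr qs] rs].
rewrite !rmorphM !rmorphB !rmorphXn /= !substX.
have [pl|pl] := eqVneq p l.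
  by rewrite (on4 r) ?(on4 s) ?subrr ?mulr0 ?mul0r // -pl eq_sym.
have [ql|ql] := eqVneq q l.
  by rewrite (on4 r) ?(on4 s) ?subrr ?mulr0 ?mul0r // -ql eq_sym.
by rewrite (on4 p) ?(on4 q) ?subrr ?mul0r.
Qed.

(* [quad i j k l * ('X_i * 'X_j)] and [quad i k j l * ('X_i * 'X_k)] generate the ideal of the
   line locally; dividing them by the two equations of the line and multiplying the
   cofactors gives a conductor. *)
Lemma line_conductor i j k l a b : a != 0 -> b != 0 -> a ^+ 4 = 1 -> b ^+ 4 = 1 ->
  uniq [:: i; j; k; l] -> exists u v : R,
  [/\ quad i j k l * ('X_i * 'X_j) = u * ('X_j - a%:MP * 'X_i),
      quad i k j l * ('X_i * 'X_k) = v * ('X_k - b%:MP * 'X_i)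
    & subst (on_line i j k a b) (u * v) != 0].
Proof.
move=> a0 b0 a4 b4; rewrite /= andbT !in_cons !in_nil !orbF !negb_or.
move=> /and3P[/and3P[ij ik il] /andP[jk jl] kl].
(* The geometric sum completing ['X_p - c 'X_i] to ['X_i ^+ 4 - 'X_p ^+ 4]; on the line it becomes
   [- 4 c^3 'X_i^3], nonzero as the characteristic is not 2. *)
pose cof c p : R := - ('X_p ^+ 3 + c%:MP * 'X_i * 'X_p ^+ 2 +
  c%:MP ^+ 2 * 'X_i ^+ 2 * 'X_p + c%:MP ^+ 3 * 'X_i ^+ 3).
have cofE c p : c ^+ 4 = 1 -> 'X_i ^+ 4 - 'X_p ^+ 4 = cof c p * ('X_p - c%:MP * 'X_i).
  move=> c4; have c4' : c%:MP ^+ 4 = 1 :> R by rewrite -rmorphXn /= c4 mpolyC1.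
  by rewrite -['X_i ^+ 4]mul1r -c4' /cof; ring.
exists (cof a j * ('X_k ^+ 4 - 'X_l ^+ 4) * ('X_i * 'X_j)).
exists (cof b k * ('X_j ^+ 4 - 'X_l ^+ 4) * ('X_i * 'X_k)).
split; first by rewrite /quad (cofE a j a4); ring.
  by rewrite /quad (cofE b k b4); ring.
pose tau : {rmorphism R -> R} := subst (on_line i j k a b).
have tauE p : tau 'X_p = on_line i j k a b p by exact: substX.
have tauC c : tau c%:MP = c%:MP by exact: substC.
have [ji ki li] : [/\ j != i, k != i & l != i] by split; rewrite eq_sym.
have [kj lj lk] : [/\ k != j, l != j & l != k] by split; rewrite eq_sym.
have tauXi : tau 'X_i = 'X_i by rewrite tauE /on_line (negPf ij) (negPf ik).
have tauXj : tau 'X_j = a%:MP * 'X_i by rewrite tauE /on_line eqxx.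
have tauXk : tau 'X_k = b%:MP * 'X_i by rewrite tauE /on_line (negPf kj) eqxx.
have tauXl : tau 'X_l = 'X_l by rewrite tauE /on_line (negPf lj) (negPf lk).
have four_neq0 : 4%:R != 0 :> R.
  by rewrite -mpolyC_nat mpolyC_eq0 (natrM _ 2 2) mulf_neq0.
have tau_cof c p : c != 0 -> tau 'X_p = c%:MP * 'X_i -> tau (cof c p) != 0.
  move=> c0 tauXp; rewrite /cof rmorphN !rmorphD !rmorphM tauXp tauXi tauC.
  rewrite (_ : - _ = - (4%:R * (c%:MP ^+ 3 * 'X_i ^+ 3))); last by ring.
  by rewrite oppr_eq0 !mulf_neq0 ?mpolyC_eq0 ?mpolyX_neq0.
have four p c : c ^+ 4 = 1 -> (c%:MP * 'X_p) ^+ 4 = 'X_p ^+ 4 :> R.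
  by move=> c4; rewrite exprMn -rmorphXn /= c4 mpolyC1 mul1r.
change (tau (cof a j * ('X_k ^+ 4 - 'X_l ^+ 4) * ('X_i * 'X_j) *
  (cof b k * ('X_j ^+ 4 - 'X_l ^+ 4) * ('X_i * 'X_k))) != 0).
rewrite !(rmorphM tau) !mulf_neq0 ?tau_cof //.
- by rewrite rmorphB !rmorphXn tauXk tauXl four // fourth_neq0.
- by rewrite tauXi mpolyX_neq0.
- by rewrite tauXj mpolyCX_neq0.
- by rewrite rmorphB !rmorphXn tauXj tauXl four // fourth_neq0.
- by rewrite tauXi mpolyX_neq0.
by rewrite tauXk mpolyCX_neq0.
Qed.

Lemma uniq4_swap23 i j k l : uniq [:: i; j; k; l] -> uniq [:: i; k; j; l].
Proof.
by rewrite -[uniq [:: i; k; j; l]](perm_uniq (_ : perm_eq [:: i; j; k; l] _)) //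
  perm_cons (perm_catCA [:: j] [:: k] [:: l]).
Qed.

(** The prime is the colon ideal [(I : u v)]: [u v] carries both equations of the line into [I], and
    it does not vanish on the line. *)
Lemma line_associated_prime (I : R -> Prop) i j k l a b :
  is_ideal I -> a \in roots4 zeta -> b \in roots4 zeta -> uniq [:: i; j; k; l] ->
  I (quad i j k l * ('X_i * 'X_j)) -> I (quad i k j l * ('X_i * 'X_k)) ->
  (forall f, I f -> subst (on_line i j k a b) f = 0) ->
  is_associated_prime I (fun f => subst (on_line i j k a b) f = 0).
Proof.
move=> [_ [ID IM]] a_root b_root ijkl I1 I2 I_line.
have [a4 b4] := (roots4P zeta2 a_root, roots4P zeta2 b_root).
have [a0 b0] := (roots4_neq0 zeta2 a_root, roots4_neq0 zeta2 b_root).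
split; first exact: subst_ker_prime.
have [u [v [uE vE uv0]]] := line_conductor a0 b0 a4 b4 ijkl.
exists (u * v) => f; split=> [f0|/I_line/eqP]; last first.
  by rewrite rmorphM mulf_eq0 (negPf uv0) orbF => /eqP.
have [p pj pk|c [d]] := @subst_congr2 _ _ (on_line i j k a b) j k f.
  by rewrite /on_line (negPf pj) (negPf pk).
have kj : k != j.
  by move: ijkl; rewrite /= !inE; case: (k =P j) => // ->; rewrite eqxx andbF.
rewrite f0 subr0 {1 2}/on_line eqxx (negPf kj) eqxx => ->.
have -> : (c * ('X_j - a%:MP * 'X_i) + d * ('X_k - b%:MP * 'X_i)) * (u * v) =
  (c * v) * (quad i j k l * ('X_i * 'X_j)) + (d * u) * (quad i k j l * ('X_i * 'X_k)).
  by rewrite uE vE; ring.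
by apply: (ID); apply: (IM).
Qed.

(** The multiplier [s] does not vanish on the line, so its blow-up has nonzero constant term and
    cancels. *)
Lemma local_contraction_blowup (I : R -> Prop) m i j k a b f :
  (forall g, I g -> subst (on_line i j k a b) g = 0) ->
  local_contraction (ideal_pow I m) (fun g => subst (on_line i j k a b) g = 0) f ->
  divides ('X ^+ m) (blowup i j k a b f).
Proof.
move=> I_line [s [/eqP s_line sf]].
apply: (@cop_Xn _ (blowup i j k a b s)); first by rewrite blowup0.
rewrite -rmorphM; apply: ideal_pow_divides sf => g Ig.
by apply: divides_X_horner0; rewrite blowup0; apply: I_line.
Qed.

(** A multiplier [s] outside [P] carries ['X_i] and ['X_j] into [I], and [quad i j k l] lies in
    [('X_i, 'X_j)^4]; so [s^4] carries it into [I^4], and [n] such factors reach [I^(4n)]. *)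
Lemma contraction_two_vars (I P : R -> Prop) m n i j k l g : uniq [:: i; j; k; l] ->
  is_ideal I -> I (quad i k j l * ('X_i * 'X_k)) -> I (quad j l i k * ('X_j * 'X_l)) ->
  is_prime_ideal P -> P 'X_i -> P 'X_j -> ~ P 'X_k -> ~ P 'X_l -> (m <= 4 * n)%N ->
  local_contraction (ideal_pow I m) P (quad i j k l ^+ n * g).
Proof.
move=> ijkl [_ [ID IM]] I1 I2 primeP Pi Pj Pk Pl le_m.
have [[P0 [PD PM]] [P1 Pprime]] := primeP.
have X4_notin p : ~ P 'X_p -> ~ P ('X_p ^+ 4).
  by move=> Pp /(prime_ideal_exp primeP).
(* Modulo ['X_i] and ['X_j] this form is ['X_k ^+ 4 * 'X_l ^+ 4]. *)
have quad_notin : ~ P (quad i k j l).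
  move=> Pq; have /Pprime[] : P ('X_k ^+ 4 * 'X_l ^+ 4); try exact: X4_notin.
  have -> : 'X_k ^+ 4 * 'X_l ^+ 4 = quad i k j l +
      ((- 'X_i ^+ 3 * ('X_j ^+ 4 - 'X_l ^+ 4)) * 'X_i + ('X_k ^+ 4 * 'X_j ^+ 3) * 'X_j) :> R.
    by rewrite /quad; ring.
  by apply: (PD) => //; apply: (PD); apply: (PM).
pose s := quad i k j l * ('X_k * 'X_l).
have s_notin : ~ P s by move=> /Pprime[//|/Pprime[]].
have sXi : I (s * 'X_i).
  have -> : s * 'X_i = 'X_l * (quad i k j l * ('X_i * 'X_k)) by rewrite /s; ring.
  exact: IM.
have sXj : I (s * 'X_j).
  have -> : s * 'X_j = 'X_k * (quad j l i k * ('X_j * 'X_l)) by rewrite /s /quad; ring.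
  exact: IM.
exists (s ^+ (4 * n)); split; first by move=> /(prime_ideal_exp primeP).
have -> : s ^+ (4 * n) * (quad i j k l ^+ n * g) = (s ^+ 4 * quad i j k l) ^+ n * g.
  by rewrite exprM [in RHS]exprMn mulrA.
apply: ideal_mulr; first exact: ideal_pow_is_ideal.
apply: (ideal_pow_leq le_m); apply: ideal_powX.
have -> : s ^+ 4 * quad i j k l =
    ('X_k ^+ 4 - 'X_l ^+ 4) * ((s * 'X_i) ^+ 4) + - ('X_k ^+ 4 - 'X_l ^+ 4) * ((s * 'X_j) ^+ 4).
  by rewrite /quad !exprMn; ring.
have [_ [IpD IpM]] := ideal_pow_is_ideal I 4.
by apply: IpD; apply: (IpM); apply: ideal_pow_exp.
Qed.

End Saturation.

(** * The Fermat ideal *)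

Section FermatIdeal.
Local Notation quad := (@quad CC).
Local Notation zero2 := (@zero2 CC).
Implicit Types (i j k l p q r : 'I_4) (f g : Rpoly) (P : Rpoly -> Prop).

Local Notation o0 := (@Ordinal 4 0 isT).
Local Notation o1 := (@Ordinal 4 1 isT).
Local Notation o2 := (@Ordinal 4 2 isT).
Local Notation o3 := (@Ordinal 4 3 isT).

Lemma exists_imaginary_unit : exists zeta : CC, zeta ^+ 2 = -1.
Proof. by exists 'i%C; apply: sqr_i. Qed.

Lemma CC_two_neq0 : 2%:R != 0 :> CC.
Proof. by have := pnatr_eq0 (complex Rdefinitions.R) 2; rewrite /CC => ->. Qed.

Lemma I4_is_ideal : is_ideal I4.
Proof. exact: ideal_span_is_ideal. Qed.

Lemma I4_min_gens (J : Rpoly -> Prop) : is_ideal J ->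
  (forall f, f \in I4_gens -> J f) -> forall f, I4 f -> J f.
Proof. exact: ideal_span_min. Qed.

Lemma I4_gens_quadE : I4_gens =
  [:: quad o0 o1 o2 o3 * ('X_o0 * 'X_o1); quad o2 o3 o0 o1 * ('X_o2 * 'X_o3);
      quad o0 o2 o1 o3 * ('X_o0 * 'X_o2); quad o1 o3 o0 o2 * ('X_o1 * 'X_o3);
      quad o0 o3 o1 o2 * ('X_o0 * 'X_o3); quad o1 o2 o0 o3 * ('X_o1 * 'X_o2)].
Proof. by rewrite /I4_gens /quad -/vx -/vy -/vz -/vw; do !congr cons; ring. Qed.

(** Permuting the variables permutes the six generators up to sign. *)
Lemma I4_gen i j k l : uniq [:: i; j; k; l] -> I4 (quad i j k l * ('X_i * 'X_j)).
Proof.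
have gen n f : (n < 6)%N -> f = nth 0 I4_gens n \/ f = - nth 0 I4_gens n -> I4 f.
  have Igen : (n < 6)%N -> I4 (nth 0 I4_gens n) by move=> n6; apply/mem_ideal_span/mem_nth.
  by move=> /Igen In [] -> //; apply: ideal_opp; first exact: I4_is_ideal.
move=> ijkl; move: gen ijkl; rewrite I4_gens_quadE /quad.
elim/ord4_ind: i; elim/ord4_ind: j => //; elim/ord4_ind: k => //; elim/ord4_ind: l => //.
all: rewrite -/vx -/vy -/vz -/vw; move: vx vy vz vw => x y z w gen _.
all: let use n := (apply: (gen n) => //=; first [left; ring | right; ring]) in
  first [use 0%N | use 1%N | use 2%N | use 3%N | use 4%N | use 5%N].
Qed.

Lemma I4_min (J : Rpoly -> Prop) : is_ideal J ->
  (forall i j k l, uniq [:: i; j; k; l] -> J (quad i j k l * ('X_i * 'X_j))) ->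
  forall f, I4 f -> J f.
Proof.
move=> idJ Jgen; apply: I4_min_gens => // f; rewrite I4_gens_quadE.
by do ![rewrite in_cons => /predU1P[-> | ]; first exact: Jgen].
Qed.

Lemma I4_sub_pencil f : I4 f ->
  exists A B, f = A * quad o0 o1 o2 o3 + B * quad o0 o2 o1 o3.
Proof.
move: f; apply: I4_min_gens => [|f].
  move: (quad _ _ _ _) (quad _ _ _ _) => F G.
  split; first by exists 0, 0; ring.
  split=> [f g [A [B ->]] [A' [B' ->]]|r f [A [B ->]]].
    by exists (A + A'), (B + B'); ring.
  by exists (r * A), (r * B); ring.
rewrite /I4_gens /quad -/vx -/vy -/vz -/vw; move: vx vy vz vw => x y z w.
rewrite !in_cons in_nil orbF => /or4P[/eqP->|/eqP->|/eqP->|/or3P[] /eqP->].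
- by exists (x * y), 0; ring.
- by exists (z * w), 0; ring.
- by exists 0, (x * z); ring.
- by exists 0, (y * w); ring.
(* The generators built on [H] are rewritten by [H = G - F]. *)
- by exists (- (x * w)), (x * w); ring.
by exists (- (y * z)), (y * z); ring.
Qed.

Lemma I4_vanish p q f : p != q -> I4 f -> subst (zero2 p q) f = 0.
Proof.
move=> pq; move: f; apply: I4_min => [|i j k l ijkl].
  exact: (subst_ker_prime (zero2 p q)).1.
exact: zero2_quad.
Qed.

(** The first hypothesis places [f] in [(F, G)], the second makes it vanish on all six coordinate
    lines. Any three of the four variables include ['X_o0] or ['X_o1]. *)
Lemma I4_saturated f : (I4 ('X_o0 * f) \/ I4 ('X_o1 * f)) ->
  (forall p q, p != q -> exists r, [/\ r != p, r != q & I4 ('X_r * f)]) -> I4 f.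
Proof.
have [zeta zeta2] := exists_imaginary_unit.
move=> pencil lines.
have [A [B fE]] : exists A B, f = A * quad o0 o1 o2 o3 + B * quad o0 o2 o1 o3.
  case: pencil => /I4_sub_pencil[A [B fE]].
    exact: (quad_nonzerodivisor zeta2 _ fE).
  (* Exchanging x with y and z with w fixes both [F] and [G]. *)
  have [||A' [B' ->]] := @quad_nonzerodivisor _ _ zeta2 o1 o0 o3 o2 f A B.
  - by [].
  - by rewrite fE /quad; ring.
  by exists A', B'; rewrite /quad; ring.
rewrite fE; apply: mem_of_vanishing => //; try exact: I4_is_ideal.
- exact: I4_gen.
- by rewrite (_ : quad _ _ _ _ = quad o2 o3 o0 o1); [apply: I4_gen | rewrite /quad; ring].
- exact: I4_gen.
- by rewrite (_ : quad _ _ _ _ = quad o1 o3 o0 o2); [apply: I4_gen | rewrite /quad; ring].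
- exact: I4_gen.
- by rewrite (_ : quad _ _ _ _ = quad o1 o2 o0 o3); [apply: I4_gen | rewrite /quad; ring].
move=> p q pq; rewrite -fE; have [r [rp rq /(I4_vanish pq)]] := lines p q pq.
exact: zero2_cancel.
Qed.

Lemma I4_on_line i j k l (a b : CC) f : a ^+ 4 = 1 -> b ^+ 4 = 1 ->
  uniq [:: i; j; k; l] -> I4 f -> subst (on_line i j k a b) f = 0.
Proof.
move=> a4 b4 ijkl; move: f; apply: I4_min => [|p q r s pqrs].
  exact: (subst_ker_prime (on_line i j k a b)).1.
exact: (on_line_quad a4 b4 ijkl).
Qed.

(** * Lower bound on the degree *)

Lemma symbolic_power_blowup (zeta : CC) m f i j k (a b : CC) :
  zeta ^+ 2 = -1 -> uniq [:: i; j; k] -> a \in roots4 zeta -> b \in roots4 zeta ->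
  symbolic_power I4 m f -> divides ('X ^+ m) (blowup i j k a b f).
Proof.
move=> zeta2 ijk a_root b_root If.
have [l ijkl] : exists l, uniq [:: i; j; k; l].
  move: ijk; clear; elim/ord4_ind: i; elim/ord4_ind: j => //; elim/ord4_ind: k => // _;
  first [by exists o0 | by exists o1 | by exists o2 | by exists o3].
have I_line g : I4 g -> subst (on_line i j k a b) g = 0.
  exact: (I4_on_line (roots4P zeta2 a_root) (roots4P zeta2 b_root) ijkl).
apply: local_contraction_blowup (I_line) _; apply: If.
apply: (line_associated_prime zeta2 CC_two_neq0 I4_is_ideal a_root b_root ijkl) => //.
  exact: I4_gen.
exact/I4_gen/uniq4_swap23.
Qed.

Lemma symbolic_power_degree m f e :
  symbolic_power I4 m f -> f != 0 -> f \is e.-homog -> (8 * m <= e)%N.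
Proof.
move=> If f0 f_homog; have [zeta zeta2] := exists_imaginary_unit.
(* [msize f] is [e + 1], so a strict bound on [msize] gives [8 * m <= e]. *)
rewrite -ltnS -(msize_dhomog f0 f_homog).
apply: (msize_gt_of_order zeta2 CC_two_neq0 f0) => i j k a b ijk a_root b_root.
exact: (symbolic_power_blowup zeta2).
Qed.

(** * Associated primes and a form of degree 8m *)

(** With [P] the colon ideal [(I4 : f)], three variables in [P] bring [f] into [I4] by saturation,
    and then 1 lies in [P]. *)
Lemma associated_prime_vars P p q r : is_associated_prime I4 P ->
  uniq [:: p; q; r] -> P 'X_p -> P 'X_q -> P 'X_r -> False.
Proof.
move=> [[_ [P1 _]] [f PE]] pqr /PE Ip /PE Iq /PE Ir; apply/P1/PE.
rewrite mul1r.
have I_pqr t : t \in [:: p; q; r] -> I4 ('X_t * f).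
  by rewrite !inE => /or3P[] /eqP->; [exact: Ip | exact: Iq | exact: Ir].
apply: I4_saturated => [|i j ij].
  have : (o0 \in [:: p; q; r]) || (o1 \in [:: p; q; r]).
    move: pqr; clear; elim/ord4_ind: p; elim/ord4_ind: q => //;
    by elim/ord4_ind: r.
  by case/orP => /I_pqr; [left | right].
have : has (fun t => (t != i) && (t != j)) [:: p; q; r].
  move: pqr ij; clear; elim/ord4_ind: p; elim/ord4_ind: q => //; elim/ord4_ind: r => //= _;
  by elim/ord4_ind: i; elim/ord4_ind: j.
by case/hasP => t /I_pqr It /andP[ti tj]; exists t.
Qed.

(** Each of [F], [G], [H] splits the variables into two pairs, one of which avoids ['X_i]; so the
    product [s] of the other three variables carries each form into [I4]. *)
Lemma contraction_one_var P m a b c i j k l : is_prime_ideal P ->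
  uniq [:: i; j; k; l] -> ~ P 'X_j -> ~ P 'X_k -> ~ P 'X_l -> m = (a + (b + c))%N ->
  local_contraction (ideal_pow I4 m) P
    (quad o0 o1 o2 o3 ^+ a * (quad o0 o2 o1 o3 ^+ b * quad o0 o3 o1 o2 ^+ c)).
Proof.
move=> primeP ijkl Pj Pk Pl ->; have [_ [_ Pprime]] := primeP.
pose s : Rpoly := 'X_j * 'X_k * 'X_l.
have s_dvd p q : p != q -> p != i -> q != i -> exists d, s = d * ('X_p * 'X_q).
  move=> pq pi qi; have := ord4_cover q ijkl; have := ord4_cover p ijkl.
  rewrite !in_cons !in_nil !orbF (negPf pi) (negPf qi) /= /s.
  move=> /or3P[] /eqP p_eq /or3P[] /eqP q_eq; move: pq; rewrite p_eq q_eq;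
  move: ('X_j : Rpoly) ('X_k : Rpoly) ('X_l : Rpoly) => x y z;
  first [by case/eqP | move=> _];
  by [exists x; ring | exists y; ring | exists z; ring].
have sI p q r t : uniq [:: p; q; r; t] -> I4 (s * quad p q r t).
  move=> pqrt; have [_ [_ IM]] := I4_is_ideal.
  have := pqrt; rewrite /= andbT !in_cons !in_nil !orbF !negb_or.
  move=> /and3P[/and3P[pq pr pt] /andP[qr qt] rt].
  have sX u v g : u != v -> u != i -> v != i -> I4 (g * ('X_u * 'X_v)) -> I4 (s * g).
    move=> uv ui vi Ig; have [d ->] := s_dvd u v uv ui vi.
    by rewrite -mulrA [_ * g]mulrC; apply: IM.
  have Iquad' : I4 (quad p q r t * ('X_r * 'X_t)).
    by rewrite -quadC; apply: I4_gen; rewrite -(rot_uniq 2).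
  have Iquad := I4_gen pqrt.
  have [pi|pi] := eqVneq p i.
    by apply: (sX r t _ rt _ _ Iquad'); rewrite -pi eq_sym.
  have [qi|qi] := eqVneq q i; last exact: (sX p q _ pq pi qi Iquad).
  by apply: (sX r t _ rt _ _ Iquad'); rewrite -qi eq_sym.
exists (s ^+ (a + (b + c))); split.
  by move=> /(prime_ideal_exp primeP)/Pprime[/Pprime[]|].
rewrite mul_exp3.
by do ![apply: ideal_powM]; apply: ideal_pow_exp; exact: sI.
Qed.

(** A prime containing two variables concerns the exponent of a single form, which has to be at
    least [m / 4]; primes containing at most one variable only ask for total exponent [m]. *)
Lemma symbolic_power_witness (m q c : nat) : m = (q + (q + c))%N -> (q <= c)%N -> (m <= 4 * q)%N ->
  symbolic_power I4 m
    (quad o0 o1 o2 o3 ^+ q * (quad o0 o2 o1 o3 ^+ q * quad o0 o3 o1 o2 ^+ c)).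
Proof.
move=> mE le_qc le_m P assP; have primeP := assP.1.
set W := _ * _.
have two i j k l n g : uniq [:: i; j; k; l] -> W = quad i j k l ^+ n * g ->
    P 'X_i -> P 'X_j -> ~ P 'X_k -> ~ P 'X_l -> (m <= 4 * n)%N ->
    local_contraction (ideal_pow I4 m) P W.
  move=> ijkl -> Pi Pj Pk Pl le_n.
  apply: contraction_two_vars => //; first exact: I4_is_ideal.
    exact/I4_gen/uniq4_swap23.
  by apply/I4_gen; rewrite -(rot_uniq 2); apply: uniq4_swap23.
have le_mc : (m <= 4 * c)%N by apply: leq_trans le_m _; rewrite leq_mul2l.
have F_eq : W = quad o0 o1 o2 o3 ^+ q * (quad o0 o2 o1 o3 ^+ q * quad o0 o3 o1 o2 ^+ c) by [].
have G_eq : W = quad o0 o2 o1 o3 ^+ q * (quad o0 o1 o2 o3 ^+ q * quad o0 o3 o1 o2 ^+ c).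
  exact: mulrCA.
have H_eq : W = quad o0 o3 o1 o2 ^+ c * (quad o0 o1 o2 o3 ^+ q * quad o0 o2 o1 o3 ^+ q).
  by rewrite /W mulrA mulrC.
(* The same factorizations, read for the complementary pairs of variables. *)
have F_eq' := F_eq; rewrite -(quadC CC o0 o1 o2 o3) in F_eq'.
have G_eq' := G_eq; rewrite -(quadC CC o0 o2 o1 o3) in G_eq'.
have H_eq' := H_eq; rewrite -(quadC CC o0 o3 o1 o2) in H_eq'.
have three := @associated_prime_vars P _ _ _ assP.
have one i j k l := @contraction_one_var P m q q c i j k l primeP.
(* Sixteen cases: three variables in [P] are impossible, exactly two are handled by [two], at most
   one by [one]. *)
have [P0|P0] := classic (P 'X_o0); have [P1|P1] := classic (P 'X_o1);
have [P2|P2] := classic (P 'X_o2); have [P3|P3] := classic (P 'X_o3);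
first [ exact: (False_ind _ (three o0 o1 o2 isT P0 P1 P2))
      | exact: (False_ind _ (three o0 o1 o3 isT P0 P1 P3))
      | exact: (False_ind _ (three o0 o2 o3 isT P0 P2 P3))
      | exact: (False_ind _ (three o1 o2 o3 isT P1 P2 P3))
      | exact: (two o0 o1 o2 o3 q _ isT F_eq P0 P1 P2 P3 le_m)
      | exact: (two o2 o3 o0 o1 q _ isT F_eq' P2 P3 P0 P1 le_m)
      | exact: (two o0 o2 o1 o3 q _ isT G_eq P0 P2 P1 P3 le_m)
      | exact: (two o1 o3 o0 o2 q _ isT G_eq' P1 P3 P0 P2 le_m)
      | exact: (two o0 o3 o1 o2 c _ isT H_eq P0 P3 P1 P2 le_mc)
      | exact: (two o1 o2 o0 o3 c _ isT H_eq' P1 P2 P0 P3 le_mc)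
      | exact: (one o0 o1 o2 o3 isT P1 P2 P3 mE)
      | exact: (one o1 o0 o2 o3 isT P0 P2 P3 mE)
      | exact: (one o2 o0 o1 o3 isT P0 P1 P3 mE)
      | exact: (one o3 o0 o1 o2 isT P0 P1 P2 mE) ].
Qed.

Lemma symbolic_power_form m : (3 <= m)%N -> m <> 5%N ->
  exists f, symbolic_power I4 m f /\ f != 0 /\ f \is (8 * m)%N.-homog.
Proof.
(* [q] is [m / 4] rounded up. Then [q <= c], that is [3 q <= m], holds for all [m >= 3] except
   [m = 5], where [q = 2] and [c = 1]. *)
move=> m3 m5; pose q := ((m + 3) %/ 4)%N; pose c := (m - 2 * q)%N.
have mE : m = (q + (q + c))%N by rewrite /c /q; lia.
have le_qc : (q <= c)%N by rewrite /c /q; lia.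
have le_m : (m <= 4 * q)%N by rewrite /q; lia.
have [zeta zeta2] := exists_imaginary_unit.
have Iw := symbolic_power_witness mE le_qc le_m.
eexists; split; first exact Iw.
split; first by rewrite !mulf_neq0 // expf_neq0 // (quad_neq0 zeta2).
have -> : (8 * m = 8 * q + (8 * q + 8 * c))%N by rewrite {1}mE !mulnDr.
by apply: dhomogM; [|apply: dhomogM]; apply: dhomogMn; apply: (dhomog_quad zeta2).
Qed.

End FermatIdeal.

Local Close Scope ring_scope.

Theorem theorem3p3 (m : nat) :
  (3 <= m)%N -> m <> 5%N -> alpha_eq (symbolic_power I4 m) (8 * m).
Proof.
move=> m3 m5; split; first exact: symbolic_power_form.
by move=> f e; apply: symbolic_power_degree.
Qed.
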